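(* Consider an infinite sequence $(x^k)_{k\in\mathbb{N}}$, with auxiliary points $(w^k)_{k\in\mathbb{N}}$ and tolerance parameters $(\nu_k)_{k\in\mathbb{N}}$, generated by Algorithm SGM (described in the context) under Assumptions A1, A2 and A3 (stated in the context). Let $$\tau_{\min}:=\min\Big\{1,\frac{\underline\omega(1-\sigma)}{\alpha_{\max}\mu L}\Big\}.$$ Then, for every integer $N\ge1$, $$\min\{\|w^k-x^k\|:\ k=0,1,\ldots,N-1\}\le\sqrt{\frac{2\alpha_{\max}\mu\left[f(x^0)-f^*+\sum_{k=0}^{\infty}\nu_k\right]}{\sigma\tau_{\min}}}\ \frac{1}{\sqrt N}.$$
   Context: Notation: $\mathbb{N}=\{0,1,2,\ldots\}$; $\langle\cdot,\cdot\rangle$ and $\|\cdot\|$ are the Euclidean inner product and norm on $\mathbb{R}^n$. $C\subseteq\mathbb{R}^n$ is nonempty, closed and convex, $f:\mathbb{R}^n\to\mathbb{R}$ is continuously differentiable, $f^*:=\inf_{x\in C}f(x)$, and the set $\Omega^*$ of minimizers of $f$ on $C$ is assumed nonempty. For $\mu\ge 1$, $\mathcal{D}_\mu$ is the set of symmetric positive definite $n\times n$ matrices with all eigenvalues in $[1/\mu,\mu]$. For $D\in\mathcal{D}_\mu$, $\|d\|_D:=\sqrt{\langle Dd,d\rangle}$ and $\mathcal{P}_C^D(v):=\arg\min_{z\in C}\|z-v\|_D^2$. For $u\in C$, $v\in\mathbb{R}^n$, $\zeta\in(0,1]$, $\gamma\ge0$, $$\mathcal{P}_{C,\zeta}^D(u,v):=\{w\in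 C:\ \|w-v\|_D^2\le\zeta\|\mathcal{P}_C^D(v)-v\|_D^2+(1-\zeta)\|u-v\|_D^2\},$$ $$\mathcal{R}_{C,\gamma}^D(u,v):=\{w\in C:\ \langle D(v-w),y-w\rangle\le\gamma\|w-u\|_D^2\ \ \forall y\in C\}.$$ Algorithm SGM. Step 0: choose $\sigma,\zeta_{\min}\in(0,1)$, $\delta_{\min}\in[0,1)$, $0<\underline\omega<\bar\omega<1$, $0<\alpha_{\min}\le\alpha_{\max}$, $\mu\ge1$, $x^0\in C$, $\nu_0\ge0$; set $k=0$. Step 1: choose $\alpha_k\in[\alpha_{\min},\alpha_{\max}]$, $\zeta_k$ with $0<\zeta_{\min}<\zeta_k\le1$, and $D_k\in\mathcal{D}_\mu$. Set $z^k:=x^k-\alpha_kD_k^{-1}\nabla f(x^k)$ and take any $w^k\in\mathcal{P}_{C,\zeta_k}^{D_k}(x^k,z^k)$. If $w^k=x^k$, stop. Step 2: set $\tau_{\rm trial}=1$. If $f(x^k+\tau_{\rm trial}(w^k-x^k))\le f(x^k)+\sigma\tau_{\rm trial}\langle\nabla f(x^k),w^k-x^k\rangle+\nu_k$, set $\tau_k=\tau_{\rm trial}$, $x^{k+1}=x^k+\tau_k(w^k-x^k)$ and go to Step 3. Otherwise choose $\tau_{\rm new}\in[\underline\omega\tau_{\rm trial},\bar\omega\tau_{\rm trial}]$, set $\tau_{\rm trial}=\tau_{\rm new}$ and repeat the test. Step 3: take $\delta_{k+1}\in[\delta_{\min},1]$ and choose $\nu_{k+1}$ with $0\le\nu_{k+1}\le(1-\delta_{k+1})[f(x^k)+\nu_k-f(x^{k+1})]$.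 Set $k\leftarrow k+1$ and go to Step 1. Assumption A1: for all $k\in\mathbb{N}$, the point $w^k$ in Step 1 is taken in $\mathcal{R}_{C,\gamma_k}^{D_k}(x^k,z^k)$ with $\gamma_k=(1-\zeta_k)/2$. Assumption A2: $\nu_k\ge0$ for all $k$ and $\sum_{k=0}^{+\infty}\nu_k<+\infty$. Assumption A3: $\nabla f$ is Lipschitz continuous in $C$ with constant $L>0$, i.e. $\|\nabla f(x)-\nabla f(y)\|\le L\|x-y\|$ for all $x,y\in C$. *)

(* Defs.v *)
(* Vectors of R^n are column vectors 'cV[R]_n.  The norm
   that the library puts on 'cV[R]_n is the sup norm: it only enters through the
   topology (closedness, continuity, differentiability), which is the Euclidean
   one; every metric quantity below uses the Euclidean product [dotp]. *)
From HB Require Import structures.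
From mathcomp Require Import all_boot all_order all_algebra.
From mathcomp Require Import all_classical all_reals all_analysis.
Import Order.TTheory GRing.Theory Num.Theory.
Import numFieldNormedType.Exports.

Set Implicit Arguments.
Unset Strict Implicit.
Unset Printing Implicit Defensive.

Local Open Scope classical_set_scope.
Local Open Scope ring_scope.

Section EuclideanSpace.
Context {R : realType} {n : nat}.
Implicit Types (u v w d x : 'cV[R]_n) (D : 'M[R]_n) (C : set 'cV[R]_n).
Implicit Types (f : 'cV[R]_n -> R).

Definition dotp u v : R := \sum_(i < n) u i 0 * v i 0.

Definition enorm d : R := Num.sqrt (dotp d d).

Definition normD D d : R := Num.sqrt (dotp (D *m d) d).

Definition grad f x : 'cV[R]_n := \col_i 'D_(delta_mx i 0) f x.

Definition continuously_differentiable f : Prop :=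
  (forall x, differentiable f x) /\ continuous (grad f).

Definition argmin C f : set 'cV[R]_n :=
  [set x | C x /\ forall y, C y -> f x <= f y].

Definition pos_def D : Prop := forall d, d != 0 -> 0 < dotp (D *m d) d.

Definition Dset (mu : R) : set 'M[R]_n :=
  [set D | [/\ D \is symmetricmx, pos_def D &
               forall a, eigenvalue D a -> mu^-1 <= a <= mu]].

(* For C nonempty, closed and convex and D positive definite the argmin is a
   singleton; the default value v of xget is then irrelevant. *)
Definition proj C D v : 'cV[R]_n :=
  xget v (argmin C (fun z => normD D (z - v) ^+ 2)).

Definition inexact_proj C (zeta : R) D u v : set 'cV[R]_n :=
  [set w | C w /\
    normD D (w - v) ^+ 2 <=
      zeta * normD D (proj C D v - v) ^+ 2 + (1 - zeta) * normD D (u - v) ^+ 2].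

Definition inexact_proj_R C (gamma : R) D u v : set 'cV[R]_n :=
  [set w | C w /\
    forall y, C y -> dotp (D *m (v - w)) (y - w) <= gamma * normD D (w - u) ^+ 2].

Definition scaled_grad_step f (alpha : R) D x : 'cV[R]_n :=
  x - alpha *: (invmx D *m grad f x).

Definition grad_lipschitz_on C f (L : R) : Prop :=
  forall x y, C x -> C y -> enorm (grad f x - grad f y) <= L * enorm (x - y).

Definition nonmonotone_armijo f (sigma nu : R) x w (t : R) : Prop :=
  f (x + t *: (w - x)) <= f x + sigma * t * dotp (grad f x) (w - x) + nu.

End EuclideanSpace.

(* [backtrack test lo hi t tau]: starting from the trial step t, the loop
   accepts tau after finitely many rejections, each rejected trial being replaced
   by an arbitrary new one in [lo * trial, hi * trial]. *)
Inductive backtrack {R : realType} (test : R -> Prop) (lo hi : R) :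
    R -> R -> Prop :=
| Backtrack_accept t : test t -> backtrack test lo hi t t
| Backtrack_reject t t' tau :
    ~ test t -> lo * t <= t' <= hi * t -> backtrack test lo hi t' tau ->
    backtrack test lo hi t tau.

Record sgm_params (R : realType) := SgmParams {
  sigma : R;
  zeta_min : R;
  delta_min : R;
  omega_lo : R;
  omega_hi : R;
  alpha_min : R;
  alpha_max : R;
  mu_bound : R;
  sigmaP : 0 < sigma < 1;
  zeta_minP : 0 < zeta_min < 1;
  delta_minP : 0 <= delta_min < 1;
  omegaP : [/\ 0 < omega_lo, omega_lo < omega_hi & omega_hi < 1];
  alphaP : 0 < alpha_min <= alpha_max;
  mu_boundP : 1 <= mu_bound }.

(* An infinite execution: the stopping test w^k = x^k is never met, and delta is
   only constrained at the indices k.+1. *)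
Record sgm_run (R : realType) (n : nat) (C : set 'cV[R]_n) (f : 'cV[R]_n -> R)
    (p : sgm_params R) := SgmRun {
  run_x : nat -> 'cV[R]_n;
  run_w : nat -> 'cV[R]_n;
  run_z : nat -> 'cV[R]_n;
  run_D : nat -> 'M[R]_n;
  run_alpha : nat -> R;
  run_zeta : nat -> R;
  run_tau : nat -> R;
  run_delta : nat -> R;
  run_nu : nat -> R;
  run_x0 : C (run_x 0%N);
  run_nu0 : 0 <= run_nu 0%N;
  run_alphaP : forall k, alpha_min p <= run_alpha k <= alpha_max p;
  run_zetaP : forall k, zeta_min p < run_zeta k <= 1;
  run_DP : forall k, Dset (mu_bound p) (run_D k);
  run_zE : forall k, run_z k =
        scaled_grad_step f (run_alpha k) (run_D k) (run_x k);
  run_wP : forall k,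
        inexact_proj C (run_zeta k) (run_D k) (run_x k) (run_z k) (run_w k);
  run_w_neq : forall k, run_w k <> run_x k;
  run_tauP : forall k,
        backtrack (nonmonotone_armijo f (sigma p) (run_nu k) (run_x k) (run_w k))
          (omega_lo p) (omega_hi p) 1 (run_tau k);
  run_xS : forall k, run_x k.+1 = run_x k + run_tau k *: (run_w k - run_x k);
  run_deltaP : forall k, delta_min p <= run_delta k.+1 <= 1;
  run_nuS : forall k, 0 <= run_nu k.+1 <=
        (1 - run_delta k.+1) * (f (run_x k) + run_nu k - f (run_x k.+1)) }.

Section Assumptions.
Context {R : realType} {n : nat} {C : set 'cV[R]_n} {f : 'cV[R]_n -> R}.
Context {p : sgm_params R}.

Definition assumption_A1 (s : sgm_run C f p) : Prop :=
  forall k, inexact_proj_R C ((1 - run_zeta s k) / 2) (run_D s k)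
              (run_x s k) (run_z s k) (run_w s k).

Definition nu_sum (s : sgm_run C f p) : \bar R :=
  (\sum_(0 <= k <oo) (run_nu s k)%:E)%E.

Definition assumption_A2 (s : sgm_run C f p) : Prop :=
  (forall k, 0 <= run_nu s k) /\ (nu_sum s < +oo)%E.

End Assumptions.

Definition tau_min {R : realType} (p : sgm_params R) (L : R) : R :=
  Num.min 1 (omega_lo p * (1 - sigma p) / (alpha_max p * mu_bound p * L)).

(* Main.v *)
(* Testing the inclusion w^k in R_(C,gamma_k) at the point y = x^k gives
   2 alpha_k <grad f(x^k), d^k> <= - (1 + zeta_k) |d^k|_D^2 for d^k = w^k - x^k,
   hence 2 alpha_max mu <grad f(x^k), d^k> <= - |d^k|^2.  With the quadratic upper
   bound coming from the Lipschitz gradient, a step can only be rejected when it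
   exceeds (1 - sigma) / (alpha_max mu L), so tau_k >= tau_min.  The Armijo test
   then yields sigma tau_min |d^k|^2 <= 2 alpha_max mu (f(x^k) - f(x^(k+1)) + nu_k),
   which telescopes. *)
Require Import Defs.
From HB Require Import structures.
From mathcomp Require Import all_boot all_order all_algebra.
From mathcomp Require Import all_classical all_reals all_analysis.
From mathcomp Require Import ring lra.
Import Order.TTheory GRing.Theory Num.Theory.
Import numFieldNormedType.Exports.
Local Open Scope classical_set_scope.
Local Open Scope ring_scope.

(** * Euclidean product, quadratic forms and their eigenvalue bounds *)

Section DotProduct.
Context {R : realType} {n : nat}.
Implicit Types (u v w x y : 'cV[R]_n) (A D : 'M[R]_n).

Lemma dotpC u v : dotp u v = dotp v u.
Proof. by apply: eq_bigr => i _; rewrite mulrC. Qed.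

Lemma dotpDl u v w : dotp (u + v) w = dotp u w + dotp v w.
Proof. by rewrite -big_split; apply: eq_bigr => i _; rewrite !mxE mulrDl. Qed.

Lemma dotpZl (a : R) u v : dotp (a *: u) v = a * dotp u v.
Proof. by rewrite mulr_sumr; apply: eq_bigr => i _; rewrite !mxE mulrA. Qed.

Lemma dotp0l u : dotp 0 u = 0.
Proof. by rewrite -(scale0r 0) dotpZl mul0r. Qed.

Lemma dotpNl u v : dotp (- u) v = - dotp u v.
Proof. by rewrite -scaleN1r dotpZl mulN1r. Qed.

Lemma dotpBl u v w : dotp (u - v) w = dotp u w - dotp v w.
Proof. by rewrite dotpDl dotpNl. Qed.

Lemma dotpDr u v w : dotp u (v + w) = dotp u v + dotp u w.
Proof. by rewrite dotpC dotpDl !(dotpC _ u). Qed.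

Lemma dotpZr (a : R) u v : dotp u (a *: v) = a * dotp u v.
Proof. by rewrite dotpC dotpZl dotpC. Qed.

Lemma dotpNr u v : dotp u (- v) = - dotp u v.
Proof. by rewrite dotpC dotpNl dotpC. Qed.

Lemma dotp_ge0 u : 0 <= dotp u u.
Proof. by apply: sumr_ge0 => i _; rewrite -expr2 sqr_ge0. Qed.

Lemma dotp_gt0 u : u != 0 -> 0 < dotp u u.
Proof.
move=> u0; rewrite lt_def dotp_ge0 andbT; apply: contraNneq u0 => uu0.
apply/eqP/colP => i; rewrite mxE; apply/eqP; rewrite -sqrf_eq0 expr2.
have /psumr_eq0P/(_ uu0 i isT)-> // : forall j, true -> 0 <= u j 0 * u j 0.
by move=> j _; rewrite -expr2 sqr_ge0.
Qed.

Lemma enorm_ge0 u : 0 <= enorm u.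
Proof. exact: sqrtr_ge0. Qed.

Lemma sqr_enorm u : enorm u ^+ 2 = dotp u u.
Proof. by rewrite sqr_sqrtr ?dotp_ge0. Qed.

Lemma enormZ (a : R) u : enorm (a *: u) = `|a| * enorm u.
Proof.
by rewrite /enorm dotpZl dotpZr mulrA -expr2 sqrtrM ?sqr_ge0// sqrtr_sqr.
Qed.

Lemma dotp_mulmx_sum A u v :
  dotp (A *m u) v = \sum_i \sum_j A i j * (u j 0 * v i 0).
Proof.
apply: eq_bigr => i _; rewrite mxE mulr_suml.
by apply: eq_bigr => j _; rewrite mulrA.
Qed.

Lemma dotp_mulmx_tr A u v : dotp (A *m u) v = dotp u (A^T *m v).
Proof.
rewrite [RHS]dotpC !dotp_mulmx_sum exchange_big; apply: eq_bigr => i _.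
by apply: eq_bigr => j _; rewrite mxE (mulrC (v _ _)).
Qed.

Lemma symmetricmx_tr A : A \is symmetricmx -> A^T = A.
Proof.
by move/is_hermitianmxP; rewrite expr0 scale1r map_mx_id // => {2}->.
Qed.

Lemma psd_cauchy_schwarz A x y :
  A^T = A -> (forall u, 0 <= dotp (A *m u) u) ->
  dotp (A *m x) y ^+ 2 <= dotp (A *m x) x * dotp (A *m y) y.
Proof.
move=> symA psdA.
have quad (s t : R) : 0 <= s ^+ 2 * dotp (A *m x) x
    + 2 * s * t * dotp (A *m x) y + t ^+ 2 * dotp (A *m y) y.
  have := psdA (s *: x + t *: y).
  rewrite mulmxDr -!scalemxAr !(dotpDl, dotpDr, dotpZl, dotpZr).
  rewrite (_ : dotp (A *m y) x = dotp (A *m x) y); last first.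
    by rewrite dotp_mulmx_tr symA dotpC.
  by lra.
have := psdA x; have := psdA y; move: quad.
move: (dotp (A *m x) y) (dotp (A *m x) x) (dotp (A *m y) y) => b a c quad c0 a0.
(* The pair [(c, - b)] turns the quadratic into [c * (a * c - b ^+ 2)], and the factor [c > 0]
   cancels. *)
have [c_gt0|c_le0] := ltP 0 c.
  have := quad c (- b); rewrite -(pmulr_rge0 _ c_gt0) => h.
  rewrite -subr_ge0 -(pmulr_rge0 _ c_gt0).
  have := quad c (- b); nra.
have cE : c = 0 by lra.
(* For [c = 0] this pair gives [- (a + 2) * b ^+ 2 >= 0], so [b = 0]. *)
have := quad b (- (a + 1)); rewrite cE.
have := sqr_ge0 b; nra.
Qed.

Lemma cauchy_schwarz u v : dotp u v <= enorm u * enorm v.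
Proof.
have psd1 x : 0 <= dotp (1%:M *m x) x by rewrite mul1mx dotp_ge0.
have := psd_cauchy_schwarz 1%:M u v (trmx1 _ _) psd1; rewrite !mul1mx => uv_le.
apply: (le_trans (ler_norm _)).
rewrite -(@ler_pXn2r _ 2) ?nnegrE ?mulr_ge0 ?enorm_ge0 //.
by rewrite real_normK ?num_real // exprMn !sqr_enorm.
Qed.

Lemma quadratic_form_bound A :
  exists2 M : R, 0 < M & forall x, `|dotp (A *m x) x| <= M * dotp x x.
Proof.
(* The added 1 keeps the constant positive when [A = 0]. *)
pose M := \sum_i \sum_j `|A i j|; exists (1 + M).
  by rewrite ltr_pwDl // sumr_ge0 // => i _; rewrite sumr_ge0.
move=> x; apply: (@le_trans _ _ (M * dotp x x)); last first.
  by rewrite ler_wpM2r ?dotp_ge0 // lerDr.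
rewrite dotp_mulmx_sum mulr_suml (le_trans (ler_norm_sum _ _ _)) //.
apply: ler_sum => i _; rewrite mulr_suml (le_trans (ler_norm_sum _ _ _)) //.
apply: ler_sum => j _; rewrite normrM ler_wpM2l //.
have sqr_le k : x k 0 ^+ 2 <= dotp x x.
  rewrite /dotp (bigD1 k) //= expr2 lerDl.
  by apply: sumr_ge0 => l _; rewrite -expr2 sqr_ge0.
have := sqr_le i; have := sqr_le j.
by case: (ger0P (x j 0 * x i 0)) => _; nra.
Qed.

(* Cauchy-Schwarz for the form of A, applied to A^-1 x and x, gives
   |x|^4 <= <A^-1 x, x> <A x, x>. *)
Lemma unit_psd_coercive A :
  A^T = A -> (forall u, 0 <= dotp (A *m u) u) -> A \in unitmx ->
  exists2 e : R, 0 < e & forall x, e * dotp x x <= dotp (A *m x) x.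
Proof.
move=> symA psdA uA; have [M M0 hM] := quadratic_form_bound (invmx A).
exists M^-1; first by rewrite invr_gt0.
move=> x; rewrite -(ler_pM2l M0) mulVKf ?gt_eqF //.
have [->|x0] := eqVneq x 0.
  by rewrite mulmx0 !dotp0l mulr0.
have := @psd_cauchy_schwarz A (invmx A *m x) x symA psdA.
rewrite mulKVmx // (dotpC x (_ *m _)) => h.
have := le_trans (ler_norm _) (hM x); have := dotp_gt0 x x0.
have := psdA x; nra.
Qed.

(* The supremum lambda of the t with t |y|^2 <= <D y, y> is an eigenvalue:
   otherwise D - lambda would be positive semidefinite and invertible, hence
   coercive, and lambda could be increased. *)
Lemma quadratic_form_ge_eigenvalue_bound D (c : R) x :
  D^T = D -> (forall a, eigenvalue D a -> c <= a) ->
  c * dotp x x <= dotp (D *m x) x.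
Proof.
move=> symD eig_ge; have [->|x0] := eqVneq x 0.
  by rewrite mulmx0 !dotp0l mulr0.
pose S := [set t : R | forall y, t * dotp y y <= dotp (D *m y) y].
have [M M0 hM] := quadratic_form_bound D.
(* [- M] lies in [S], and the Rayleigh quotient at the nonzero [x] bounds [S] above. *)
have S_sup : has_sup S.
  split.
    exists (- M) => y; rewrite mulNr lerNl.
    by rewrite (le_trans _ (hM y)) // -normrN ler_norm.
  exists (dotp (D *m x) x / dotp x x) => t /(_ x).
  by rewrite -ler_pdivlMr // dotp_gt0.
have sup_in : S (sup S).
  move=> y; have [->|y0] := eqVneq y 0.
    by rewrite mulmx0 !dotp0l mulr0.
  rewrite -ler_pdivlMr ?dotp_gt0 //; apply: ge_sup; first by case: S_sup.
  by move=> t /(_ y); rewrite ler_pdivlMr ?dotp_gt0.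
apply: (le_trans _ (sup_in x)); rewrite ler_wpM2r ?dotp_ge0 //.
(* An eigenvalue is an [a] with [D - a%:M] singular, so invertibility at [sup S] is what must be
   refuted. *)
apply: eig_ge; rewrite /eigenvalue /eigenspace kermx_eq0 row_free_unit.
have formE t y : dotp ((D - t%:M) *m y) y = dotp (D *m y) y - t * dotp y y.
  by rewrite mulmxBl mul_scalar_mx dotpBl dotpZl.
apply/negP => /unit_psd_coercive[].
- by rewrite linearB /= symD tr_scalar_mx.
- by move=> y; rewrite formE subr_ge0.
move=> e e0 he.
have /(ub_le_sup (proj2 S_sup)) : S (sup S + e).
  by move=> y; have := he y; rewrite formE; lra.
by lra.
Qed.

End DotProduct.

(** * Descent lemma for a gradient that is Lipschitz on a convex set *)

Section Descent.
Context {R : realType} {n : nat}.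
Implicit Types (x y d : 'cV[R]_n) (f : 'cV[R]_n -> R) (C : set 'cV[R]_n).

Lemma colE_delta d : d = \sum_i d i 0 *: delta_mx i 0.
Proof.
rewrite [LHS]matrix_sum_delta; apply: eq_bigr => i _.
by rewrite big_ord1.
Qed.

(** Differentiability makes the directional derivative linear in [d], which is then expanded in the
    standard basis. *)
Lemma derive_grad f x d : differentiable f x -> 'D_d f x = dotp (grad f x) d.
Proof.
move=> df; rewrite deriveE // {1}(colE_delta d) linear_sum.
apply: eq_bigr => i _.
by rewrite linearZ mxE deriveE // mulrC.
Qed.

Lemma is_derive_line f x d (t : R) : differentiable f (x + t *: d) ->
  is_derive t 1 (fun t => f (x + t *: d)) (dotp (grad f (x + t *: d)) d).
Proof.
move=> df; pose q h := h^-1 *: ((f \o shift (x + t *: d)) (h *: d) - f (x + t *: d)).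
(* The difference quotient of the restriction to the line, in direction 1, is that of [f] in
   direction [d]. *)
have qE : (fun h => h^-1 *: (((fun t => f (x + t *: d)) \o shift t) (h *: 1)
    - f (x + t *: d))) = q.
  apply/funext => h; rewrite /q /=; congr (_ *: (f _ - _)).
  by rewrite scalerDl addrCA /GRing.scale /= mulr1.
split; first by rewrite /derivable qE; exact: diff_derivable.
by rewrite /derive qE -derive_grad.
Qed.

Lemma convex_segment C x y (t : R) :
  convex_set C -> C x -> C y -> 0 <= t <= 1 -> C (x + t *: (y - x)).
Proof.
move=> convC Cx Cy t01.
(* The weight [t] falls on the first point, hence [y] before [x]. *)
have := convC y x (Itv01 (proj1 (andP t01)) (proj2 (andP t01))).
rewrite !inE => /(_ Cy Cx); congr C.
rewrite /conv /= scalerBl scale1r scalerBr.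
by rewrite addrCA.
Qed.

(** The gap [phi] between [f] on the segment and its quadratic model is nonincreasing: the segment
    stays in [C], so Cauchy-Schwarz and the Lipschitz bound make its derivative nonpositive.
    Monotonicity replaces integration of the gradient. *)
Lemma descent_lemma C f (L : R) x y (t : R) :
  convex_set C -> (forall x, differentiable f x) -> grad_lipschitz_on C f L ->
  C x -> C y -> 0 <= t <= 1 ->
  f (x + t *: (y - x)) <= f x + t * dotp (grad f x) (y - x)
                          + L / 2 * t ^+ 2 * dotp (y - x) (y - x).
Proof.
move=> convC df lipf Cx Cy /andP[t0 t1]; set d := y - x.
pose phi (s : R) : R := f (x + s *: d) - s * dotp (grad f x) d
  - L / 2 * s ^+ 2 * dotp d d.
have dphi (s : R) : is_derive s 1 phi
    (dotp (grad f (x + s *: d)) d - dotp (grad f x) d - L * s * dotp d d).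
  have h := is_derive_line f x d s (df _).
  apply: is_derive_eq.
  by rewrite /GRing.scale /=; field.
suff : phi t <= phi 0.
  by rewrite /phi scale0r addr0 expr0n /=; lra.
apply: (@ler0_derive1_nincr _ _ 0 1) => //; last first.
  by apply: derivable_within_continuous => s _.
move=> s; rewrite in_itv /= => /andP[s0 s1]; rewrite derive1E derive_val.
rewrite -dotpBl lerBlDr add0r; apply: (le_trans (cauchy_schwarz _ _)).
have := lipf (x + s *: d) x.
rewrite addrAC subrr add0r enormZ gtr0_norm // => lip.
rewrite -sqr_enorm expr2 !mulrA ler_wpM2r ?enorm_ge0 // -mulrA.
by apply: lip => //; apply: convex_segment => //; rewrite !ltW.
Qed.

End Descent.

(** * Slope along the inexact projection direction *)

Section DescentDirection.
Context {R : realType} {n : nat}.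
Implicit Types (C : set 'cV[R]_n) (f : 'cV[R]_n -> R) (D : 'M[R]_n).
Implicit Types (d x w : 'cV[R]_n).

Lemma sqr_normD D d : pos_def D -> normD D d ^+ 2 = dotp (D *m d) d.
Proof.
move=> posD; rewrite sqr_sqrtr //.
have [->|d0] := eqVneq d 0; last by rewrite ltW // posD.
by rewrite mulmx0 dotp0l.
Qed.

Lemma pos_def_unitmx D : pos_def D -> D \in unitmx.
Proof.
(* [kermx] is a left kernel: the rows of [kermx D^T], transposed, are vectors killed by [D]. *)
move=> posD; rewrite -unitmx_tr -row_free_unit -kermx_eq0.
apply/eqP/row_matrixP => i; rewrite row0; apply/eqP/contraT => ri0.
have /posD : (row i (kermx D^T))^T != 0 by rewrite trmx_eq0.
have -> : D *m (row i (kermx D^T))^T = 0.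
  by rewrite -[D in D *m _]trmxK -trmx_mul -row_mul mulmx_ker row0 trmx0.
by rewrite dotp0l ltxx.
Qed.

(** With d = w - x, the test point [x] gives alpha <grad f(x), d> <= - (1 - gamma) |d|_D^2. Then 2
    (1 - gamma) >= 1, and the eigenvalue bound replaces |d|_D^2 by |d|^2 / mu. *)
Lemma inexact_proj_R_descent C f (mu alpha gamma : R) D x w :
  gamma <= 1 / 2 -> Dset mu D -> C x ->
  inexact_proj_R C gamma D x (scaled_grad_step f alpha D x) w ->
  2 * alpha * dotp (grad f x) (w - x) <= - (mu^-1 * dotp (w - x) (w - x)).
Proof.
move=> g12 [symD posD eigD] Cx [_ /(_ _ Cx)].
have -> : scaled_grad_step f alpha D x - w
    = - (w - x) - alpha *: (invmx D *m grad f x).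
  by rewrite /scaled_grad_step opprB addrAC.
rewrite mulmxBr -scalemxAr mulKVmx ?pos_def_unitmx // mulmxN -(opprB w x).
move: (w - x) => d; rewrite dotpBl dotpNl !dotpNr dotpZl opprK.
have : mu^-1 * dotp d d <= dotp (D *m d) d.
  apply: quadratic_form_ge_eigenvalue_bound; first exact: symmetricmx_tr.
  by move=> a /eigD /andP[].
have := sqr_ge0 (normD D d); rewrite sqr_normD //.
nra.
Qed.

End DescentDirection.

(** * Backtracking and the rate of a running minimum *)

Lemma backtrack_lower_bound {R : realType} (test : R -> Prop) (lo hi b t tau : R) :
  0 < lo -> hi <= 1 ->
  (forall u, 0 < u <= 1 -> ~ test u -> b <= lo * u) ->
  backtrack test lo hi t tau -> 0 < t <= 1 ->
  [/\ test tau, 0 < tau <= 1 & Num.min t b <= tau].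
Proof.
move=> lo0 hi1 rejected; elim=> {t tau} [t ok t01|t t' tau bad /andP[lot thi] _ IH t01].
  by split=> //; rewrite ge_min lexx.
have := t01 => /andP[t0 t1].
have [|ok tau01 le_tau] := IH.
  by rewrite (lt_le_trans _ lot) ?mulr_gt0 //=; nra.
(* The successor of a rejected trial cannot fall below the threshold: [b <= lo * t <= t']. *)
split=> //; apply: le_trans le_tau; rewrite le_min !ge_min lexx orbT andbT.
by rewrite (le_trans (rejected t t01 bad) lot) orbT.
Qed.

(** The minimum m satisfies N m^2 <= sum of the F_k^2 <= Q. As [0 < N], the seed [F 0] is itself one
    of the terms. *)
Lemma bigmin_le_rate {R : realType} (F : nat -> R) (Q : R) (N : nat) :
  (forall k, 0 <= F k) -> (0 < N)%N -> \sum_(0 <= k < N) F k ^+ 2 <= Q ->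
  \big[Num.min/F 0%N]_(0 <= k < N) F k <= Num.sqrt Q * (1 / Num.sqrt N%:R).
Proof.
move=> F0 N0 sumQ; set m := \big[_/_]_(_ <= _ < _) _.
have m0 : 0 <= m.
  by apply: (big_ind (fun x => 0 <= x)) => // a b a0 b0; rewrite le_min a0.
have N0' : 0 < N%:R :> R by rewrite ltr0n.
rewrite div1r ler_pdivlMr ?sqrtr_gt0 // -[m]ger0_norm // -sqrtr_sqr.
rewrite -sqrtrM ?sqr_ge0 // ler_wsqrtr //; apply: le_trans sumQ.
rewrite mulr_natr -[X in _ *+ X]subn0 -sumr_const_nat.
rewrite big_nat [leRHS]big_nat; apply: ler_sum => k kN.
rewrite ler_pXn2r ?nnegrE //.
by apply: ge_bigmin_seq; rewrite ?mem_index_iota.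
Qed.

(** * Step sizes, feasibility and summation along a run *)

Section Convergence.
Context {R : realType} {n : nat} {C : set 'cV[R]_n} {f : 'cV[R]_n -> R}.
Context {p : sgm_params R} (s : sgm_run C f p) (L : R).
Hypotheses (C_convex : convex_set C) (f_diff : forall x, differentiable f x).
Hypotheses (A1 : assumption_A1 s) (A2 : assumption_A2 s).
Hypotheses (L_gt0 : 0 < L) (A3 : grad_lipschitz_on C f L).

Let step k := run_w s k - run_x s k.
Let slope k := dotp (grad f (run_x s k)) (step k).

Lemma alpha_mu_gt0 : 0 < alpha_max p * mu_bound p.
Proof.
have := alphaP p; have := mu_boundP p => mu1 /andP[a0 a1].
by apply: mulr_gt0; [exact: lt_le_trans a1|exact: lt_le_trans mu1].
Qed.

Lemma tau_min_gt0 : 0 < tau_min p L.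
Proof.
rewrite lt_min ltr01 divr_gt0 // mulr_gt0 ?alpha_mu_gt0 //.
  by case: (omegaP p).
by rewrite subr_gt0; case/andP: (sigmaP p).
Qed.

Lemma slope_le k : C (run_x s k) ->
  2 * (alpha_max p * mu_bound p) * slope k <= - dotp (step k) (step k).
Proof.
move=> Cx; have := A1 k; rewrite (run_zE s k) => wR.
have g12 : (1 - run_zeta s k) / 2 <= 1 / 2.
  by have := zeta_minP p; have := run_zetaP s k => /andP[? _] /andP[? _]; lra.
have := inexact_proj_R_descent _ _ _ _ _ _ _ _ g12 (run_DP s k) Cx wR; rewrite -/(step k) -/(slope k).
have mu0 : 0 < mu_bound p := lt_le_trans ltr01 (mu_boundP p).
rewrite -(ler_pM2l mu0) mulrN mulVKf ?gt_eqF // => le_slope.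
have alpha0 : 0 < run_alpha s k.
  by have /andP[a0 _] := alphaP p; have /andP[/(lt_le_trans a0)] := run_alphaP s k.
(* The sign of the slope is what allows [run_alpha s k] to be raised to [alpha_max p]. *)
have slope0 : slope k <= 0.
  have : 0 < mu_bound p * run_alpha s k by rewrite mulr_gt0.
  by have := dotp_ge0 (step k); nra.
have : mu_bound p * run_alpha s k <= mu_bound p * alpha_max p.
  by rewrite ler_pM2l //; case/andP: (run_alphaP s k).
by nra.
Qed.

(** Let g be the slope, q = |d^k|^2 and a = alpha_max mu. Rejection, nu_k >= 0 and the descent lemma
    give (1 - sigma) (- g) < L u q / 2; since q <= - 2 a g, cancelling q bounds u below. *)
Lemma rejected_step_ge k (u : R) : C (run_x s k) -> 0 < u <= 1 ->
  ~ nonmonotone_armijo f (sigma p) (run_nu s k) (run_x s k) (run_w s k) u ->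
  omega_lo p * (1 - sigma p) / (alpha_max p * mu_bound p * L) <= omega_lo p * u.
Proof.
move=> Cx /andP[u0 u1] /negP; rewrite -ltNge => fail.
have lo0 : 0 < omega_lo p by case: (omegaP p).
rewrite -mulrA ler_pM2l // ler_pdivrMr ?(mulr_gt0 alpha_mu_gt0) //.
have Cw : C (run_w s k) by case: (A1 k).
have u01 : 0 <= u <= 1 by rewrite ltW.
have := descent_lemma C f L _ _ u C_convex f_diff A3 Cx Cw u01.
move: fail; rewrite -/(step k) -/(slope k) => fail desc.
have nu0 : 0 <= run_nu s k by case: A2.
(* The stopping test is never met, so q can be cancelled. *)
have q0 : 0 < dotp (step k) (step k).
  by apply: dotp_gt0; rewrite subr_eq0; apply/eqP; exact: run_w_neq.
have /andP[_ s1] := sigmaP p.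
have := slope_le _ Cx; move: (slope k) (dotp _ _) q0 desc fail => g q q0 desc fail.
have : u * ((1 - sigma p) * - g) < u * (L / 2 * u * q) by nra.
rewrite ltr_pM2l // => gq le_q.
rewrite -(ler_pM2r q0).
have := alpha_mu_gt0; set a := _ * _ => a0.
have : (1 - sigma p) * q <= (1 - sigma p) * (- (2 * a * g)).
  by rewrite ler_pM2l ?subr_gt0 // lerNr.
have : 2 * a * ((1 - sigma p) * - g) <= 2 * a * (L / 2 * u * q).
  by rewrite ler_pM2l ?ltW // mulr_gt0.
by lra.
Qed.

Lemma run_tau_ge k : C (run_x s k) ->
  [/\ nonmonotone_armijo f (sigma p) (run_nu s k) (run_x s k) (run_w s k)
        (run_tau s k),
      0 < run_tau s k <= 1 & tau_min p L <= run_tau s k].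
Proof.
move=> Cx; case: (omegaP p) => lo0 _ hi1.
apply: (backtrack_lower_bound _ _ _ _ _ _ lo0 (ltW hi1) _ (run_tauP s k)).
  by move=> u; apply: rejected_step_ge.
by rewrite ltr01 lexx.
Qed.

(** Feasibility and the step bounds are proved together: x^k in [C] gives tau_k in (0, 1], which
    puts x^(k+1) on the segment from x^k to w^k. This is why the preceding lemmas assume
    [C (run_x s k)]. *)
Lemma run_x_in k : C (run_x s k).
Proof.
elim: k => [|k Cx]; first exact: run_x0.
rewrite run_xS; have [_ /andP[t0 t1] _] := run_tau_ge _ Cx.
by apply: convex_segment => //; [case: (A1 k)|rewrite ltW].
Qed.

Lemma sufficient_decrease k :
  sigma p * tau_min p L * enorm (step k) ^+ 2 <=
  2 * (alpha_max p * mu_bound p) *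
    (f (run_x s k) + run_nu s k - f (run_x s k.+1)).
Proof.
have Cx := run_x_in k; have [arm /andP[t0 _] tmin] := run_tau_ge _ Cx.
move: arm; rewrite /nonmonotone_armijo -run_xS -/(step k) -/(slope k) => arm.
have /andP[s0 _] := sigmaP p.
have a0 := alpha_mu_gt0; set a := _ * mu_bound p in a0 *.
rewrite sqr_enorm; apply: (@le_trans _ _
    (sigma p * run_tau s k * (- (2 * a * slope k)))).
  apply: ler_pM; rewrite ?dotp_ge0 ?(ltW (mulr_gt0 s0 tau_min_gt0)) //.
    by rewrite ler_pM2l.
  by rewrite lerNr slope_le.
move: (slope k) arm => g; rewrite -lerBlDr -lerBrDl => arm.
rewrite mulrN [X in - X]mulrCA -mulrN ler_pM2l ?(mulr_gt0 _ a0) //; move: arm.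
by rewrite lerNl !opprB; lra.
Qed.

(** [fine] would send an infinite sum to 0; A2 makes the sum finite, so its value is kept. *)
Lemma sum_run_nu_le N : \sum_(0 <= k < N) run_nu s k <= fine (nu_sum s).
Proof.
have [nu0 fin_nu] := A2.
have nu_sum0 : (0 <= nu_sum s)%E.
  by apply: nneseries_ge0 => k _ _; rewrite lee_fin.
rewrite -lee_fin fineK ?ge0_fin_numE // -sumEFin.
by apply: nneseries_lim_ge => k _ _; rewrite lee_fin.
Qed.

Lemma sum_sqr_step_le (fstar : R) N :
  (forall x, C x -> fstar <= f x) ->
  \sum_(0 <= k < N) enorm (step k) ^+ 2 <=
  2 * alpha_max p * mu_bound p * (f (run_x s 0%N) - fstar + fine (nu_sum s))
    / (sigma p * tau_min p L).
Proof.
move=> fstar_le; have /andP[s0 _] := sigmaP p.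
rewrite ler_pdivlMr ?mulr_gt0 ?tau_min_gt0 // mulrC mulr_sumr.
apply: (@le_trans _ _ (\sum_(0 <= k < N) 2 * (alpha_max p * mu_bound p) *
    (f (run_x s k) + run_nu s k - f (run_x s k.+1)))).
  by apply: ler_sum => k _; exact: sufficient_decrease.
rewrite -mulr_sumr -[2 * alpha_max p * _]mulrA ler_pM2l ?(mulr_gt0 _ alpha_mu_gt0) //.
under eq_bigr do rewrite addrAC.
rewrite big_split /= lerD ?sum_run_nu_le //.
(* [telescope_sumr] sums forward differences, hence the change of sign. *)
under eq_bigr do rewrite -opprB.
by rewrite sumrN telescope_sumr // opprB lerB // fstar_le //; exact: run_x_in.
Qed.

End Convergence.

Theorem theorem20 (R : realType) (n : nat) (C : set 'cV[R]_n)
    (f : 'cV[R]_n -> R) (p : sgm_params R) (s : sgm_run C f p) (L : R)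
    (C_nonempty : C !=set0) (C_closed : closed C) (C_convex : convex_set C)
    (f_C1 : continuously_differentiable f)
    (minimizers_nonempty : argmin C f !=set0)
    (A1 : assumption_A1 s) (A2 : assumption_A2 s)
    (L_gt0 : 0 < L) (A3 : grad_lipschitz_on C f L)
    (N : nat) (N_ge1 : (1 <= N)%N) :
  \big[Num.min/enorm (run_w s 0%N - run_x s 0%N)]_(0 <= k < N)
      enorm (run_w s k - run_x s k)
  <= Num.sqrt (2 * alpha_max p * mu_bound p *
                 (f (run_x s 0%N) - inf [set f x | x in C] + fine (nu_sum s))
               / (sigma p * tau_min p L))
     * (1 / Num.sqrt N%:R).
Proof.
have inf_le x : C x -> inf [set f x | x in C] <= f x.
  move=> Cx; apply: ge_inf; last by exists x.
  (* [inf] is a genuine lower bound only on a set bounded below; a minimizer supplies that bound. *)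
  case: minimizers_nonempty => x0 [_ x0_min]; exists (f x0) => _ [y Cy <-].
  exact: x0_min.
apply: (bigmin_le_rate (fun k => enorm (run_w s k - run_x s k))) => //.
  by move=> k; exact: enorm_ge0.
by apply: sum_sqr_step_le => //; case: f_C1.
Qed.
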